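(* Let $\mathcal J=\{J_m:m\ge1\}$. If $J_m\in\mathcal J$, then for every $\varepsilon>\frac15$ and every potential function $\rho:V(J_m)\to\{3,4,6\}$ on $J_m$, $(J_m,\rho)$ is not $\varepsilon$-flexible.
   Context: Multigraphs are finite; they may have parallel edges but no loops. For $m\ge1$, $J_m$ is obtained from the cycle $v_1\ldots v_{2m+1}v_1$ as follows: add two new vertices $w_1$ and $w_{2m}$, and join $w_j$ to $v_j$ by two parallel edges for $j\in\{1,2m\}$; then, for each even $i\in\{2,\dots,2m-2\}$, add a second edge joining $v_i$ and $v_{i+1}$. Covers. A DP $3$-cover $(H,L)$ of a multigraph $G$ is a graph $H$ together with pairwise disjoint sets $L(v)$, $v\in V(G)$, with union $V(H)$, such that each $L(v)$ is a clique of size $3$ in $H$, and for each pair $\{x,y\}$ of distinct vertices of $G$ joined by exactly $s\ge0$ edges, the set of edges of $H$ between $L(x)$ and $L(y)$ is the union of at most $s$ matchings. Each $L(v)$ is a pointed set: it comes with a distinguished basepoint $\omega(v)\in L(v)$, which is part of the data of the cover. If $L'(v)\subseteq L(v)$ for each $v$, an $(H,L')$-coloring of $G$ is a map $\varphi:V(G)\to V(H)$ with $\varphi(v)\in L'(v)$ for all $v$ and whose image is an independent set of $H$. Potential functions. A potential function is a map $\rho:V(G)\to\{3,4,6\}$. It defines $h_\rho(v)=2$ if $\rho(v)=3$ and $h_\rho(v)=3$ if $\rho(v)\in\{4,6\}$. List distributions. An $h_\rho$-list assignment assigns to each $v\in V(G)$ a set $L'(v)\subseteq L(v)$ of size $h_\rho(v)$.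 A list distribution $\mathcal D$ on $(G,\rho,H,L)$ is a probability distribution on $h_\rho$-list assignments; its random outcome is denoted $L_{\mathcal D}$. For a real $\varepsilon\in(0,1)$, it is $\varepsilon$-admissible if for each $v$ with $h_\rho(v)=2$ and each $c\in L(v)$, $\Pr(L(v)\setminus L_{\mathcal D}(v)=\{c\})\ge\varepsilon$. Coloring distributions. A coloring distribution $\Phi$ on $(G,\rho,H,L,\mathcal D)$ assigns to each outcome $L_{\mathcal D}$ of $\mathcal D$ a probability distribution on $(H,L_{\mathcal D})$-colorings of $G$; together with $\mathcal D$ it gives a joint distribution on pairs $(L_{\mathcal D},\phi)$ with first marginal $\mathcal D$ and with $\phi$ an $(H,L_{\mathcal D})$-coloring, and hence a random $(H,L)$-coloring $\phi$ of $G$. $\Phi$ is an $\varepsilon$-distribution if, with probabilities taken with respect to the overall joint distribution, for every $v\in V(G)$: (i) $\Pr(\phi(v)=c)\ge\varepsilon$ for each $c\in L(v)$; and (ii) if $\rho(v)=4$, then $\Pr(\phi(v)=\omega(v))=2\varepsilon$ and $\Pr(\phi(v)=c)=\frac12-\varepsilon$ for each $c\in L(v)\setminus\{\omega(v)\}$. Flexibility. $(G,\rho,H,L,\mathcal D)$ is $\varepsilon$-flexible if it has an $\varepsilon$-distribution. $(G,\rho)$ is $\varepsilon$-flexible if $(G,\rho,H,L,\mathcal D)$ is $\varepsilon$-flexible for every DP $3$-cover $(H,L)$ of $G$ (with every choice of basepoints) and every $\varepsilon$-admissible list distribution $\mathcal D$ on $(G,\rho,H,L)$.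
   Formalization: The formal theorem assumes ε ≤ 1/3 whenever ρ takes the value 3; otherwise no ε-admissible list distribution exists, (J_m,ρ) is vacuously ε-flexible, and the claim as stated fails. *)

(* Defs.v *)
From HB Require Import structures.
From mathcomp Require Import all_boot all_order all_algebra.
From mathcomp Require Import reals.
Set Implicit Arguments.
Unset Strict Implicit.
Unset Printing Implicit Defensive.
Import Order.TTheory GRing.Theory Num.Theory.
Local Open Scope ring_scope.

(* A finite loopless multigraph is given by its edge multiplicities:          *)
(* [mult x y] is the number of edges joining x and y.                         *)
Record multigraph := Multigraph {
  vert : finType;
  mult : vert -> vert -> nat;
  mult_sym : forall x y, mult x y = mult y x;
  mult_loopless : forall x, mult x x = 0%N
}.

Section JGraphs.
Variable m : nat.

(* [inl i] is v_(i+1), [inr false] is w_1 and [inr true] is w_(2m).           *)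
Definition J_vert : finType := ('I_(m.*2.+1) + bool)%type.

(* Number of edges listed from x to y: each edge of J_m is listed in exactly  *)
(* one direction. In the first case the three terms are the cycle edges       *)
(* v_a v_(a+1), the closing edge v_(2m+1) v_1, and the second edges           *)
(* v_a v_(a+1) for a even, 2 <= a <= 2m-2.                                    *)
Definition J_arc (x y : J_vert) : nat :=
  match x, y with
  | inl i, inl j =>
      let a := i.+1 in let b := j.+1 in
      (b == a.+1) + ((a == m.*2.+1) && (b == 1))
      + [&& b == a.+1, ~~ odd a & 2 <= a <= m.*2 - 2]
  | inr false, inl j => if j.+1 == 1 then 2 else 0
  | inr true, inl j => if j.+1 == m.*2 then 2 else 0
  | _, _ => 0
  end%N.

(* The test [x == y] only matters for the degenerate index m = 0.             *)
Definition J_mult (x y : J_vert) : nat :=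
  if x == y then 0%N else (J_arc x y + J_arc y x)%N.

Lemma J_mult_sym x y : J_mult x y = J_mult y x.
Proof. by rewrite /J_mult eq_sym addnC. Qed.

Lemma J_mult_loopless x : J_mult x x = 0%N.
Proof. by rewrite /J_mult eqxx. Qed.

Definition J : multigraph := Multigraph J_mult_sym J_mult_loopless.
End JGraphs.

(* DP 3-covers with basepoints; matchings are sets of pairwise disjoint edges *)
(* {a, b}, possibly empty, whence "at most s".                                *)
Record dp3_cover (G : multigraph) := Dp3Cover {
  cvert : finType;
  adj : rel cvert;
  adj_sym : symmetric adj;
  adj_irr : irreflexive adj;
  L : vert G -> {set cvert};
  omega : vert G -> cvert;
  L_disjoint : forall x y, x != y -> [disjoint L x & L y];
  L_cover : \bigcup_x L x = [set: cvert];
  L_card : forall x, #|L x| = 3%N;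
  L_clique : forall x, {in L x &, forall a b, a != b -> adj a b};
  L_matchings : forall x y, x != y ->
    exists2 M : 'I_(mult x y) -> {set {set cvert}},
      forall k, trivIset (M k) &
      \bigcup_k M k = [set [set a; b] | a in L x, b in L y & adj a b];
  omegaP : forall x, omega x \in L x
}.

Definition potential (G : multigraph) (rho : vert G -> nat) : Prop :=
  forall v, rho v \in [:: 3; 4; 6]%N.

Definition h_ (G : multigraph) (rho : vert G -> nat) (v : vert G) : nat :=
  if rho v == 3%N then 2%N else 3%N.

Definition distribution_on (R : realType) (T : finType) (A : {set T})
    (p : T -> R) : Prop :=
  [/\ forall t, 0 <= p t, forall t, t \notin A -> p t = 0 & \sum_t p t = 1].

Section Flexibility.
Variables (R : realType) (G : multigraph) (rho : vert G -> nat) (C : dp3_cover G).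

Let lists : finType := {ffun vert G -> {set cvert C}}.
Let coloring : finType := {ffun vert G -> cvert C}.

Definition list_assignments : {set lists} :=
  [set L' : lists | [forall v, (L' v \subset L C v) && (#|L' v| == h_ rho v)]].

Definition colorings (L' : lists) : {set coloring} :=
  [set phi : coloring | [forall v, phi v \in L' v]
                        && [forall u, forall v, ~~ adj (phi u) (phi v)]].

Definition list_distribution (D : lists -> R) : Prop :=
  distribution_on list_assignments D.

Definition admissible (eps : R) (D : lists -> R) : Prop :=
  forall v, h_ rho v = 2%N -> forall c, c \in L C v ->
    eps <= \sum_(L' : lists | L C v :\: L' v == [set c]) D L'.

(* The outcomes of D are the list assignments of positive probability; the    *)
(* values of Phi elsewhere are irrelevant.                                    *)
Definition coloring_distribution (D : lists -> R)
    (Phi : lists -> coloring -> R) : Prop :=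
  forall L', 0 < D L' -> distribution_on (colorings L') (Phi L').

Definition prob_color (D : lists -> R) (Phi : lists -> coloring -> R)
    (v : vert G) (c : cvert C) : R :=
  \sum_(L' : lists) \sum_(phi : coloring | phi v == c) D L' * Phi L' phi.

Definition eps_distribution (eps : R) (D : lists -> R)
    (Phi : lists -> coloring -> R) : Prop :=
  forall v,
    (forall c, c \in L C v -> eps <= prob_color D Phi v c) /\
    (rho v = 4%N ->
       prob_color D Phi v (omega C v) = 2 * eps /\
       (forall c, c \in L C v -> c != omega C v ->
          prob_color D Phi v c = 1 / 2 - eps)).

Definition flexible_for (eps : R) (D : lists -> R) : Prop :=
  exists2 Phi, coloring_distribution D Phi & eps_distribution eps D Phi.
End Flexibility.

Definition flexible (R : realType) (G : multigraph) (rho : vert G -> nat)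
    (eps : R) : Prop :=
  forall (C : dp3_cover G) (D : {ffun vert G -> {set cvert C}} -> R),
    list_distribution rho D -> admissible rho eps D -> flexible_for rho eps D.

(* Main.v *)
Require Import Defs.
From mathcomp Require Import all_boot all_order all_algebra.
From mathcomp Require Import reals.
From mathcomp Require Import zify lra.
Import Order.TTheory GRing.Theory Num.Theory.
Local Open Scope ring_scope.

(** Five vertices of the cover, no two of which lie in a common coloring, force
    5 eps <= 1.  Let every simple edge of J_m forbid the pair of colors (0, 0) and
    every multiple edge forbid all pairs of nonzero colors.  A nonzero color at w_1
    forces color 0 at v_1, and then color 0 at v_3, ..., v_(2m-1), hence a nonzero
    color at v_(2m); a nonzero color at w_(2m) forces color 0 at v_(2m); and color 0
    at v_1 or at v_(2m) forbids color 0 at v_(2m+1).  So the two nonzero colors at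
    w_1, the two at w_(2m), and color 0 at v_(2m+1) are pairwise incompatible. *)

(** The sum is the expected number of entries of [s] that the random coloring realizes, and every
    coloring realizes at most one. *)
Lemma sum_prob_color_le1 (R : realType) (G : multigraph) (rho : vert G -> nat)
    (C : dp3_cover G) (D : {ffun vert G -> {set cvert C}} -> R)
    (Phi : {ffun vert G -> {set cvert C}} -> {ffun vert G -> cvert C} -> R)
    (s : seq (vert G * cvert C)) :
  list_distribution rho D -> coloring_distribution D Phi ->
  (forall phi : {ffun vert G -> cvert C}, (forall v, phi v \in L C v) ->
     (forall u v, ~~ adj (phi u) (phi v)) ->
     (count (fun p => phi p.1 == p.2) s <= 1)%N) ->
  \sum_(p <- s) prob_color D Phi p.1 p.2 <= 1.
Proof.
move=> [D_ge0 D_supp <-] PhiP s_excl; rewrite /prob_color exchange_big /=.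
apply: ler_sum => L' _; have := D_ge0 L'.
(* [Phi] is arbitrary on outcomes of probability 0, but their terms vanish. *)
rewrite le_eqVlt => /predU1P[<-|D_gt0].
  rewrite big1 // => p _; rewrite big1 // => phi _; exact: mul0r.
have [Phi_ge0 Phi_supp Phi_sum] := PhiP _ D_gt0.
have L'_in : L' \in list_assignments rho C.
  by apply: contraTT D_gt0 => /D_supp ->; rewrite ltxx.
rewrite -[leRHS]mulr1 -Phi_sum mulr_sumr.
under eq_bigr do rewrite big_mkcond.
rewrite exchange_big /=; apply: ler_sum => phi _.
rewrite -big_mkcond big_const_seq iter_addr_0 /=.
have [phi_in|/Phi_supp ->] := boolP (phi \in colorings L'); last first.
  by rewrite mulr0 mul0rn.
rewrite -[leRHS]mulr1n ler_wpMn2l //; first by rewrite mulr_ge0 // ltW.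
move: L'_in phi_in; rewrite !inE => /forallP L'L /andP[/forallP phiL' /forallP ind].
apply: s_excl => [v|u]; last exact/forallP.
by have /andP[/subsetP sub _] := L'L v; apply: sub.
Qed.

(** * The cover determined by edge multiplicities *)

Section LinkCover.
Variable G : multigraph.
Implicit Types (x y : vert G) (i j : 'I_3).

Definition link (s : nat) i j : bool :=
  match s with
  | 0 => false
  | 1 => (i == ord0) && (j == ord0)
  | _ => (i != ord0) && (j != ord0)
  end.

Lemma link_sym s i j : link s i j = link s j i.
Proof. by case: s => [|[|s]] //=; rewrite andbC. Qed.

Definition link_adj (p q : vert G * 'I_3) : bool :=
  if p.1 == q.1 then p.2 != q.2 else link (mult p.1 q.1) p.2 q.2.

Lemma link_adj_sym : symmetric link_adj.
Proof.
by move=> p q; rewrite /link_adj mult_sym link_sym [p.1 == _]eq_sym [p.2 == _]eq_sym.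
Qed.

Lemma link_adj_irr : irreflexive link_adj.
Proof. by move=> p; rewrite /link_adj !eqxx. Qed.

Definition fiber x : {set vert G * 'I_3} := [set p | p.1 == x].

Lemma fiber_disjoint x y : x != y -> [disjoint fiber x & fiber y].
Proof.
move=> xy; apply/pred0P => p /=; rewrite !inE.
by apply: contraNF xy => /andP[/eqP <- /eqP <-].
Qed.

Lemma fiber_cover : \bigcup_x fiber x = [set: vert G * 'I_3].
Proof. by apply/setP => p; rewrite inE; apply/bigcupP; exists p.1; rewrite ?inE. Qed.

Lemma card_fiber x : #|fiber x| = 3%N.
Proof.
have -> : fiber x = [set (x, i) | i : 'I_3].
  apply/setP => -[y i]; rewrite inE; apply/eqP/imsetP => /= [->|[j _ [-> _]] //].
  by exists i.
by rewrite card_imset ?card_ord // => i j [].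
Qed.

Lemma fiber_clique x : {in fiber x &, forall a b, a != b -> link_adj a b}.
Proof.
move=> [y i] [z j]; rewrite !inE /= => /eqP-> /eqP->.
by rewrite /link_adj /= eqxx xpair_eqE eqxx.
Qed.

Definition edges_of (r : rel 'I_3) x y : {set {set vert G * 'I_3}} :=
  [set [set (x, p.1); (y, p.2)] | p in [set p : 'I_3 * 'I_3 | r p.1 p.2]].

(** The hypothesis makes [r] a partial injection, so edges sharing an endpoint coincide; as
    [x != y], endpoints in different fibers never meet. *)
Lemma trivIset_edges_of (r : rel 'I_3) x y : x != y ->
  (forall i j i' j', r i j -> r i' j' -> (i == i') = (j == j')) ->
  trivIset (edges_of r x y).
Proof.
move=> xy r_match; apply/trivIsetP => _ _ /imsetP[[i j] + ->] /imsetP[[i' j'] + ->].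
rewrite !inE /= => rij rij'; apply: contraR => /pred0Pn[p /=].
have e := r_match _ _ _ _ rij rij'; rewrite !inE => /andP[].
have yx : y == x = false by rewrite eq_sym (negbTE xy).
case/orP => /eqP-> /orP[]; rewrite xpair_eqE ?eqxx ?(negbTE xy) ?yx //= => eqi.
- by move: e; rewrite eqi => /esym/eqP->; rewrite (eqP eqi).
- by move: e; rewrite eqi => /eqP->; rewrite (eqP eqi).
Qed.

(* The pairs of nonzero colors form K_(2,2), the union of the matchings i = j and
   i <> j; they are listed at k = 0 and k = 1. *)
Definition link_part (s k : nat) i j : bool :=
  link s i j && ((1 < s)%N ==> ((i != j) == k :> nat)).

Lemma link_part_matching s k i j i' j' :
  link_part s k i j -> link_part s k i' j' -> (i == i') = (j == j').
Proof.
case: s => [|[|s]] //; rewrite /link_part /=.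
  by rewrite !andbT => /andP[/eqP-> /eqP->] /andP[/eqP-> /eqP->].
case: i j i' j' => [[|[|[|i]]] ? ] // [[|[|[|j]]] ?] // [[|[|[|i']]] ?] //
  [[|[|[|j']]] ?] //; by case: k => [|[]].
Qed.

Lemma link_matchings x y : x != y ->
  exists2 M : 'I_(mult x y) -> {set {set vert G * 'I_3}},
    forall k, trivIset (M k) &
    \bigcup_k M k
      = [set [set a; b] | a in fiber x, b in fiber y & link_adj a b].
Proof.
move=> xy; exists (fun k => edges_of (link_part (mult x y) k) x y) => [k|].
  by apply: trivIset_edges_of => // i j i' j'; apply: link_part_matching.
apply/setP => e; apply/bigcupP/imset2P => [[k _ /imsetP[[i j]]]|[[x' i] [y' j]]].
  rewrite inE /= => /andP[ij _] ->; exists (x, i) (y, j); rewrite ?inE //=.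
  by rewrite /link_adj /= (negbTE xy) eqxx.
rewrite !inE /= => /eqP-> /andP[/eqP->]; rewrite /link_adj /= (negbTE xy) => ij ->.
(* The index of the matching containing the pair; a linked pair forces multiplicity at least 1, and
   index 1 is used only when it is at least 2. *)
have lt_k : ((if (1 < mult x y)%N then nat_of_bool (i != j) else 0%N) < mult x y)%N.
  by move: ij; case: (mult x y) => [|[|s]] //= _; case: (i != j).
exists (Ordinal lt_k) => //; apply/imsetP; exists (i, j) => //.
by rewrite inE /= /link_part ij /=; case: ifP => //=; rewrite eqxx.
Qed.

Lemma fiber_basepoint x : (x, ord0) \in fiber x.
Proof. by rewrite inE. Qed.

Definition link_cover : dp3_cover G :=
  @Dp3Cover G _ link_adj link_adj_sym link_adj_irr fiber (fun x => (x, ord0))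
    fiber_disjoint fiber_cover card_fiber fiber_clique link_matchings fiber_basepoint.

Section LinkColoring.
Variable phi : {ffun vert G -> cvert link_cover}.
Hypotheses (phiL : forall v, phi v \in L link_cover v)
           (phi_ind : forall u v, ~~ adj (phi u) (phi v)).

Lemma link_coloring x y : x != y -> ~~ link (mult x y) (phi x).2 (phi y).2.
Proof.
move=> xy; have := phi_ind x y.
rewrite /= /link_adj; have := phiL x; have := phiL y.
by rewrite !inE => /eqP-> /eqP->; rewrite (negbTE xy).
Qed.

Lemma link_coloring1 x y : mult x y = 1%N ->
  (phi x).2 == ord0 -> (phi y).2 != ord0.
Proof.
move=> xy1; have [e|/link_coloring] := eqVneq x y.
  by move: xy1; rewrite e mult_loopless.
by rewrite xy1 /= negb_and => /orP[/negbTE->|].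
Qed.

Lemma link_coloring2 x y : mult x y = 2%N ->
  (phi x).2 != ord0 -> (phi y).2 == ord0.
Proof.
move=> xy2; have [e|/link_coloring] := eqVneq x y.
  by move: xy2; rewrite e mult_loopless.
by rewrite xy2 /= negb_and !negbK => /orP[->|].
Qed.

Lemma link_coloring_eqE v i : (phi v == (v, i)) = ((phi v).2 == i).
Proof.
have := phiL v; rewrite inE; case: (phi v) => a b /= /eqP->.
by rewrite xpair_eqE eqxx.
Qed.

(** Merges the two witnesses at a pendant vertex into one Boolean, which makes exclusivity a
    propositional question. *)
Lemma nonzero_countE v :
  ((phi v == (v, inord 1)) + (phi v == (v, inord 2)))%N = ((phi v).2 != ord0).
Proof.
rewrite !link_coloring_eqE -!val_eqE /= !inordK //.
by case: (phi v).2 => [[|[|[|]]]].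
Qed.

End LinkColoring.

(** * An admissible list distribution *)

Section DeletedColor.
Variables (R : realType) (rho : vert G -> nat).

(** One color is deleted at all these vertices at once: admissibility bounds each vertex separately,
    so the dependence is harmless. *)
Definition delete_color (k : 'I_3) : {ffun vert G -> {set cvert link_cover}} :=
  [ffun v => if rho v == 3%N then fiber v :\ (v, k) else fiber v].

(** Summing over [k] lets the masses add up when the three assignments coincide, as they do if [rho]
    never takes the value 3. *)
Definition deletion_distribution (L' : {ffun vert G -> {set cvert link_cover}}) : R :=
  \sum_(k < 3) if delete_color k == L' then 1 / 3 else 0.

Lemma deletion_ge0 L' : 0 <= deletion_distribution L'.
Proof. by apply: sumr_ge0 => k _; case: ifP => // _; lra. Qed.

Lemma delete_color_in k : delete_color k \in list_assignments rho link_cover.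
Proof.
rewrite inE; apply/forallP => v; rewrite ffunE /h_; case: ifP => _ /=.
  by rewrite subsetDl cardsDS ?sub1set ?inE ?card_fiber ?cards1 //=.
by rewrite subxx card_fiber.
Qed.

Lemma deletion_list_distribution : list_distribution rho deletion_distribution.
Proof.
split=> [|L' L'_out|]; first exact: deletion_ge0.
  rewrite /deletion_distribution big1 // => k _; case: eqP => // e.
  by rewrite -e delete_color_in in L'_out.
have mass k : \sum_L' (if delete_color k == L' then 1 / 3 else 0) = 1 / 3 :> R.
  by rewrite -big_mkcond (big_pred1 (delete_color k)) // => L'; exact: eq_sym.
rewrite exchange_big /= (eq_bigr _ (fun k _ => mass k)).
by rewrite !big_ord_recl big_ord0; lra.
Qed.

Lemma deletion_admissible (eps : R) :
  (forall v, rho v = 3%N -> eps <= 1 / 3) -> admissible rho eps deletion_distribution.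
Proof.
move=> eps_le v; rewrite /h_; have [rho3|//] := eqVneq (rho v) 3%N => _.
move=> [y k]; rewrite inE /= => /eqP->.
apply: le_trans (eps_le v rho3) _.
rewrite (bigD1 (delete_color k)) /=; last first.
  by rewrite ffunE rho3 eqxx setDDr setDv set0U (setIidPr _) // sub1set inE.
rewrite -[1 / 3]addr0 lerD ?sumr_ge0 //; last by move=> *; exact: deletion_ge0.
rewrite /deletion_distribution (bigD1 k) //= eqxx lerDl sumr_ge0 // => j _.
by case: ifP => // _; lra.
Qed.

End DeletedColor.
End LinkCover.

(** * Incompatible colors on J_m *)

Section JColoring.
Variables (m : nat) (hm : (1 <= m)%N).

(* [v i] is v_(i+1); [w false] and [w true] are w_1 and w_(2m). *)
Let v (i : nat) : vert (J m) := inl (inord i).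
Let w (b : bool) : vert (J m) := inr b.

(** With a = i + 1, the doubled edges v_a v_(a+1), a even, are those with [i] odd. *)
Lemma J_mult_path i : (i < m.*2)%N ->
  mult (v i) (v i.+1) = (1 + [&& odd i & i.+1 <= m.*2 - 2])%N.
Proof.
move=> lt_i; rewrite /= /J_mult /= (inj_eq inl_inj) -val_eqE /= !inordK; try lia.
rewrite ltn_eqF // !negbK; lia.
Qed.

Lemma J_mult_close : mult (v m.*2) (v 0) = 1%N.
Proof.
rewrite /= /J_mult /= (inj_eq inl_inj) -val_eqE /= !inordK; try lia.
rewrite gtn_eqF ?double_gt0 //; lia.
Qed.

Lemma J_mult_pendant1 : mult (w false) (v 0) = 2%N.
Proof. by rewrite /= /J_mult /= !inordK. Qed.

Lemma J_mult_pendant2 : mult (w true) (v m.*2.-1) = 2%N.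
Proof. by rewrite /= /J_mult /= inordK ?prednK ?double_gt0 ?eqxx. Qed.

Definition J_witnesses : seq (vert (J m) * cvert (link_cover (J m))) :=
  [:: (w false, (w false, inord 1)); (w false, (w false, inord 2));
      (w true, (w true, inord 1)); (w true, (w true, inord 2));
      (v m.*2, (v m.*2, ord0))].

Lemma J_witnesses_exclusive (phi : {ffun vert (J m) -> cvert (link_cover (J m))}) :
  (forall x, phi x \in L (link_cover (J m)) x) ->
  (forall x y, ~~ adj (phi x) (phi y)) ->
  (count (fun p => phi p.1 == p.2) J_witnesses <= 1)%N.
Proof.
move=> phiL phi_ind /=; set z := fun x => (phi x).2 == ord0.
have single x y : mult x y = 1%N -> z x -> ~~ z y by exact: link_coloring1.
have double x y : mult x y = 2%N -> ~~ z x -> z y by exact: link_coloring2.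
have w1 := double _ _ J_mult_pendant1; have w2 := double _ _ J_mult_pendant2.
have close : z (v m.*2) -> ~~ z (v 0) := single _ _ J_mult_close.
(* Here the index is odd, yet the edge is simple, because doubling stops at a = 2m - 2. *)
have last_edge : z (v m.*2.-1) -> ~~ z (v m.*2).
  have e : m.*2.-1.+1 = m.*2 by lia.
  rewrite -{2}e; apply: single; rewrite J_mult_path; lia.
(* A simple edge makes [v j.*2.+1] nonzero, then a doubled edge makes the next vertex zero;
   [j.+1 < m] ensures that it is doubled. *)
have even0 : z (v 0) -> forall j, (j < m)%N -> z (v j.*2).
  move=> z0; elim=> [//|j IHj] lt_j; apply: (double (v j.*2.+1)).
    rewrite J_mult_path; lia.
  by apply: single (IHj _); rewrite ?J_mult_path; lia.
have path : z (v 0) -> ~~ z (v m.*2.-1).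
  move=> /even0/(_ m.-1); have -> : m.*2.-1 = m.-1.*2.+1 by lia.
  move=> H; apply: single (H _); rewrite ?J_mult_path; lia.
have := nonzero_countE _ _ phiL (w false); have := nonzero_countE _ _ phiL (w true).
rewrite (link_coloring_eqE _ _ phiL (v _)) -!/(z _) => e2 e1.
rewrite addn0 addnA e1 [X in (_ + X)%N]addnA e2.
(* What remains follows propositionally from these five implications. *)
move: w1 w2 close last_edge path.
by case: (z (v 0)); case: (z (v m.*2.-1)); case: (z (v m.*2));
  case: (z (w false)); case: (z (w true)) => //= w1 w2 c l p;
  by [have := w1 isT|have := w2 isT|have := c isT|have := l isT|have := p isT].
Qed.

End JColoring.

(* If eps > 1/3 and rho takes the value 3 somewhere, no list distribution is
   eps-admissible and (J m, rho) is vacuously eps-flexible; the last hypothesis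
   excludes exactly this case. *)
Theorem mainTheorem6 (R : realType) (m : nat) (hm : (1 <= m)%N) (eps : R)
    (heps : 1 / 5 < eps) (rho : vert (J m) -> nat) (hrho : potential rho)
    (hadm : forall v : vert (J m), rho v = 3%N -> eps <= 1 / 3) :
  ~ flexible rho eps.
Proof.
have D_dist := deletion_list_distribution (J m) R rho.
move=> /(_ (link_cover (J m)) _ D_dist (deletion_admissible _ _ _ _ hadm)).
move=> [Phi PhiP Phi_eps].
have := sum_prob_color_le1 _ _ _ _ _ _ _ D_dist PhiP (J_witnesses_exclusive m hm).
have ge_eps x i : eps <= prob_color (deletion_distribution (J m) R rho) Phi x (x, i).
  by apply: (Phi_eps x).1; rewrite inE.
rewrite /J_witnesses !big_cons big_nil /= => le1.
have := ge_eps (inr false) (inord 1); have := ge_eps (inr false) (inord 2).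
have := ge_eps (inr true) (inord 1); have := ge_eps (inr true) (inord 2).
have := ge_eps (inl (inord m.*2)) ord0; lra.
Qed.
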